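(* Let $n\geq 2$, $h>0$, and let $\Pi_1:=\mathbb{H}^n\times\{0\}$ and $\Pi_2:=\mathbb{H}^n\times\{h\}$ be two slices of $\mathbb{H}^n\times\mathbb{R}$. Let $\alpha\subset\Pi_1$ and $\beta\subset\Pi_2$ be hypersurfaces (of the respective slices) homeomorphic to $\mathbb{S}^{n-1}$, such that the orthogonal projection $\beta^*$ of $\beta$ on the slice $\Pi_1$ is contained in the domain enclosed by $\alpha$. If $h\geq\pi/(2n-2)$, then there does not exist a connected compact minimal vertical graph $M$ over the domain $\Omega\subset\Pi_1$ bounded by $\alpha\cup\beta^*$, with boundary $\partial M=\alpha\cup\beta$.
   Context: $\mathbb{H}^n$ is $n$-dimensional hyperbolic space, in the ball model: the open unit ball of $\mathbb{R}^n$ with metric $\frac{dx_1^2+\cdots+dx_n^2}{F}$, $F(p)=\left(\frac{1-\|p\|^2}{2}\right)^2$; it is identified with the slice $\mathbb{H}^n\times\{0\}$. $\mathbb{H}^n\times\mathbb{R}$ carries the product metric. The domain enclosed by a hypersurface homeomorphic to $\mathbb{S}^{n-1}$ in $\mathbb{H}^n$ is the bounded connected component of its complement; $\Omega$ is the domain lying between $\alpha$ and $\beta^*$. A compact minimal vertical graph over $\Omega$ with boundary $\alpha\cup\beta$ is a set $M=\{(p,u(p)): p\in\bar\Omega\}$, where $u\in C^2(\Omega)\cap C^0(\bar\Omega)$ satisfies $u|_{\alpha}=0$, $u|_{\beta^*}=h$, and the graph has zero mean curvature over $\Omega$, equivalently $$\operatorname{div}\left(\frac{\nabla u}{\tau_u}\right)+\frac{(n-2)\,p\cdot\nabla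 u}{\tau_u\sqrt{F}}=0\ \text{ in }\Omega,\qquad \tau_u=\sqrt{1+F\|\nabla u\|^2},$$ where $\cdot$, $\|\cdot\|$, $\nabla$, $\operatorname{div}$ are Euclidean in $\mathbb{R}^n$. *)

(* Defs.v *)
From HB Require Import structures.
From mathcomp Require Import all_boot all_order all_algebra.
From mathcomp Require Import all_classical all_reals all_analysis.

Set Implicit Arguments.
Unset Strict Implicit.
Unset Printing Implicit Defensive.

Import Order.TTheory GRing.Theory Num.Theory.
Import numFieldNormedType.Exports.

Local Open Scope classical_set_scope.
Local Open Scope ring_scope.

Definition dot (R : realType) (n : nat) (p q : 'rV[R]_n) : R :=
  \sum_(i < n) p 0 i * q 0 i.

(* The library norm `|p| on row vectors is the sup norm; it induces the usual
   topology, but metric quantities need the Euclidean norm. *)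
Definition enorm (R : realType) (n : nat) (p : 'rV[R]_n) : R :=
  Num.sqrt (dot p p).

Definition sphere (R : realType) (n : nat) : set 'rV[R]_n :=
  [set p | enorm p = 1].

Definition Hyp (R : realType) (n : nat) : set 'rV[R]_n :=
  [set p | enorm p < 1].

(* The hyperbolic metric is dx^2 / confF. *)
Definition confF (R : realType) (n : nat) (p : 'rV[R]_n) : R :=
  ((1 - enorm p ^+ 2) / 2) ^+ 2.

Definition slice (R : realType) (n : nat) (t : R) : set ('rV[R]_n * R) :=
  [set x | Hyp x.1 /\ x.2 = t].

(* Orthogonal projection onto the slice at height 0, which is identified with
   the ball: the last coordinate is dropped. *)
Definition vproj (R : realType) (n : nat) (S : set ('rV[R]_n * R)) :
  set 'rV[R]_n := fst @` S.

Definition homeomorphic_sets (T U : topologicalType) (A : set T) (B : set U) :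
  Prop :=
  exists (f : T -> U) (g : U -> T),
    [/\ {within A, continuous f}, {within B, continuous g},
        (forall x, A x -> B (f x) /\ g (f x) = x) &
        (forall y, B y -> A (g y) /\ f (g y) = y)].

(* Balls of the hyperbolic metric centred at the origin are the Euclidean balls
   of radius r < 1 centred there, so this is boundedness for that metric. *)
Definition hyp_bounded (R : realType) (n : nat) (D : set 'rV[R]_n) : Prop :=
  exists2 r : R, r < 1 & D `<=` [set p | enorm p <= r].

(* For S homeomorphic to a sphere, such a D exists and is unique by the
   Jordan-Brouwer separation theorem. *)
Definition enclosed_domain (R : realType) (n : nat) (S D : set 'rV[R]_n) :
  Prop :=
  (exists2 x, (@Hyp R n `\` S) x & D = connected_component (@Hyp R n `\` S) x)
  /\ hyp_bounded D.

Definition partial (R : realType) (n : nat) (i : 'I_n) (f : 'rV[R]_n -> R)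
  (p : 'rV[R]_n) : R := 'D_(delta_mx 0 i) f p.

Definition grad (R : realType) (n : nat) (f : 'rV[R]_n -> R) (p : 'rV[R]_n) :
  'rV[R]_n := \row_(i < n) partial i f p.

Definition divergence (R : realType) (n : nat) (X : 'rV[R]_n -> 'rV[R]_n)
  (p : 'rV[R]_n) : R := \sum_(i < n) partial i (fun q => X q 0 i) p.

Definition C1_on (R : realType) (n : nat) (D : set 'rV[R]_n)
  (f : 'rV[R]_n -> R) : Prop :=
  forall (i : 'I_n) (p : 'rV[R]_n), D p ->
    derivable f p (delta_mx 0 i) /\ {for p, continuous (partial i f)}.

(* Only used for open D. *)
Definition C2_on (R : realType) (n : nat) (D : set 'rV[R]_n)
  (f : 'rV[R]_n -> R) : Prop :=
  C1_on D f /\ forall i : 'I_n, C1_on D (partial i f).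

Definition tau (R : realType) (n : nat) (u : 'rV[R]_n -> R) (p : 'rV[R]_n) : R
  := Num.sqrt (1 + confF p * enorm (grad u p) ^+ 2).

(* Zero mean curvature of the graph of u in Hyp x R, written in Euclidean
   terms.  The Riemannian divergence of the horizontal field
   confF *: grad u / tau equals confF times the left-hand side below. *)
Definition minimal_graph_equation (R : realType) (n : nat)
  (u : 'rV[R]_n -> R) (p : 'rV[R]_n) : Prop :=
  divergence (fun q => (tau u q)^-1 *: grad u q) p
  + (n%:R - 2) * dot p (grad u p) / (tau u p * Num.sqrt (confF p)) = 0.

(* M is a minimal vertical graph over Omega taking the value 0 on a and h on b,
   i.e. with boundary (a x {0}) U (b x {h}) when a and b bound Omega.  Only the
   values of u on the closure of Omega matter. *)
Definition minimal_vertical_graph (R : realType) (n : nat)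
  (Omega a b : set 'rV[R]_n) (h : R) (M : set ('rV[R]_n * R)) : Prop :=
  exists u : 'rV[R]_n -> R,
    [/\ C2_on Omega u /\ {within closure Omega, continuous u},
        (forall p, a p -> u p = 0),
        (forall p, b p -> u p = h),
        (forall p, Omega p -> minimal_graph_equation u p) &
        M = [set (p, u p) | p in closure Omega]].

(* Main.v *)
Require Import Defs.
From HB Require Import structures.
From mathcomp Require Import all_boot all_order all_algebra.
From mathcomp Require Import all_classical all_reals all_analysis.
From mathcomp Require Import ring lra.

Set Implicit Arguments.
Unset Strict Implicit.
Unset Printing Implicit Defensive.

Import Order.TTheory GRing.Theory Num.Theory.
Import numFieldNormedType.Exports.

Local Open Scope classical_set_scope.
Local Open Scope ring_scope.

(** The proof compares the graph with an explicit one-parameter family of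
    rotational barriers of height [pi / (2 n - 2)], in the place of half
    catenoids, which are only given by integrals.

    Put [m = n - 1], [s = |p|^2], and let [lambda = (1 + s) / (1 - s)] be the
    hyperbolic cosine of the distance to the origin.  For [c > 0] the function
    [w] defined by [sin (m w) = c / lambda ^ m] is a strict supersolution of the
    minimal graph equation where it is positive; it rises from [0] at infinity
    to the height [pi / (2 m)], which it reaches with a vertical tangent plane.
    Strictness is an algebraic identity, [barrier_identity], so no strong
    maximum principle is needed.

    Suppose that [u] is a solution, and let [r0] be the largest norm of a point
    of [beta*].  Among the points of the closure of [Omega] of norm at least
    [r0], consider one at which
    [J = ln (sin (dl + m u)) + m ln lambda] is maximal, where [dl > 0] is small
    and the sine is continued by [1] once its argument exceeds [pi / 2] (and by
    [sin dl] where [u < 0]).  If the maximum exceeded [m ln lambda (r0)], it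
    would be attained at an interior point of norm greater than [r0]: [u] is [0]
    on [alpha], where [J] is nonpositive by the choice of [dl].  On the plateau
    this is impossible because [lambda] increases outwards.  Off the plateau the
    graph of [u] touches the barrier from below, after a vertical translation,
    and the second derivative test along all lines through the point bounds the
    Hessian of [u] and contradicts the equation ([no_touching]).  Hence
    [dl + m u < pi / 2] at the points of [Omega] of norm greater than [r0]
    ([height_bound]).  Such points accumulate at a point of [beta*] of norm
    [r0], where [u = h], so [m h < pi / 2], against the hypothesis.

    Only two facts are needed about the enclosed domains: components of open
    sets are open and relatively closed, and the domain enclosed by a set of
    points of norm at most [r0] has the same bound on its norms, since
    otherwise it would contain a radial segment leaving every ball that bounds
    it. *)

(** * Directional derivatives *)

(** The derivative of [f] along [v] is that of its restriction to a line. *)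
Lemma is_derive_lineP (R : realType) (n : nat) (f : 'rV[R]_n -> R)
  (p v : 'rV[R]_n) (t d : R) :
  is_derive (p + t *: v) v f d <-> is_derive t 1 (fun x => f (p + x *: v)) d.
Proof.
have E : (fun h : R =>
    h^-1 *: ((f \o shift (p + t *: v)) (h *: v) - f (p + t *: v))) =
  (fun h : R =>
    h^-1 *: (((fun x => f (p + x *: v)) \o shift t) (h *: 1)
             - f (p + t *: v))).
  apply/funext => h /=; congr (_ *: (f _ - _)).
  by rewrite [h%:A]mulr1 scalerDl addrCA.
split => -[df dE]; split.
- by rewrite /derivable -E.
- by rewrite -dE /derive -E.
- by rewrite /derivable E.
- by rewrite -dE /derive E.
Qed.

Lemma second_derivative_test (R : realType) (f g : R -> R) (c : R) :
  (\forall t \near (0 : R), is_derive t (1 : R) f (g t)) ->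
  is_derive (0 : R) 1 g c ->
  (\forall t \near (0 : R), f t <= f 0) -> g 0 = 0 /\ c <= 0.
Proof.
move=> df dg fmax.
have [e /= e0 He] : exists2 e : R, 0 < e & forall t, `|t| < e ->
    is_derive t (1 : R) f (g t) /\ f t <= f 0.
  have /nbhs_ballP[e /= e0 He] : \forall t \near (0 : R),
      is_derive t (1 : R) f (g t) /\ f t <= f 0.
    by near=> t; split; near: t.
  by exists e => // t te; apply: He; rewrite /ball /= sub0r normrN.
have g00 : g 0 = 0.
  have D1 : is_derive (0 : R) 1 f 0.
    apply: (@derive1_at_max _ f (- (e / 2)) (e / 2) 0).
    - by lra.
    - move=> t; rewrite in_itv /= => /andP[a b]; have [|[]//] := He t.
      by rewrite ltr_norml; lra.
    - by rewrite in_itv /=; lra.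
    - move=> t; rewrite in_itv /= => /andP[a b]; have [|] // := He t.
      by rewrite ltr_norml; lra.
  have [|D2 _] := He 0; first by rewrite normr0.
  by case: D1 => _ E1; case: D2 => _ <-.
split=> //; rewrite leNgt; apply/negP => c0.
have [d d0 Hd] : exists2 d : R, 0 < d & forall t, 0 < t < d -> 0 < g t.
  case: dg => [dg dgE].
  have : (fun h => h^-1 *: ((g \o shift 0) (h *: 1) - g 0)) @ 0^' --> c.
    by rewrite -dgE; exact: dg.
  move/cvgrPdist_lt => /(_ _ c0) /nbhs_ballP[d /= d0 Hd].
  exists d => // t /andP[t0 td].
  have := Hd t; rewrite /ball /= sub0r normrN gtr0_norm//.
  move=> /(_ td (lt0r_neq0 t0)).
  rewrite g00 subr0 addr0 [t%:A]mulr1 ltr_distlC subrr => /andP[H _].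
  by rewrite -(pmulr_rgt0 _ (_ : 0 < t^-1)) ?invr_gt0.
pose t := Num.min d e / 2.
have t0 : 0 < t by rewrite divr_gt0// lt_min d0 e0.
have td : t < d by rewrite /t; have := ge_min d d e; rewrite lexx /=; lra.
have te : t < e by rewrite /t; have := ge_min e d e; rewrite lexx orbT /=; lra.
have [x||x] := @MVT _ f g 0 t t0.
- rewrite in_itv /= => /andP[x0 xt]; have [|] // := He x.
  by rewrite gtr0_norm//; lra.
- apply: derivable_within_continuous => x; rewrite in_itv /= => /andP[x0 xt].
  have [|[]//] := He x. by rewrite ger0_norm//; lra.
rewrite in_itv /= subr0 => /andP[x0 xt] E.
have [|_] := He t; first by rewrite gtr0_norm.
rewrite -subr_le0 E; apply/negP; rewrite -ltNge mulr_gt0// Hd// x0 /=; lra.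
Unshelve. all: by end_near. Qed.

(** [f] has strict derivative [L] at [p] along [v]: the difference quotients
    converge to [L] uniformly in the base point near [p].  Unlike plain
    directional derivatives, strict ones are additive in the direction. *)
Definition strict_derive (R : realType) (n : nat) (f : 'rV[R]_n -> R)
  (p v : 'rV[R]_n) (L : R) : Prop :=
  forall e : R, 0 < e -> exists2 d : R, 0 < d & forall q t,
    `|q - p| < d -> `|t| < d -> `|f (q + t *: v) - f q - t * L| <= e * `|t|.

Lemma strict_derive0 (R : realType) (n : nat) (f : 'rV[R]_n -> R) p :
  strict_derive f p 0 0.
Proof.
move=> e e0; exists 1 => // q t _ _.
by rewrite scaler0 addr0 subrr mulr0 subr0 normr0 mulr_ge0// ltW.
Qed.

Lemma strict_deriveD (R : realType) (n : nat) (f : 'rV[R]_n -> R) p v w L M :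
  strict_derive f p v L -> strict_derive f p w M ->
  strict_derive f p (v + w) (L + M).
Proof.
move=> fv fw e e0.
have e20 : 0 < e / 2 by lra.
have [d1 d10 H1] := fv _ e20; have [d2 d20 H2] := fw _ e20.
have v1 : 0 < 1 + `|v| by rewrite ltr_wpDr.
exists (Num.min (Num.min d1 d2) (d2 / 2 / (1 + `|v|))).
  by rewrite !lt_min d10 d20 divr_gt0//; lra.
move=> q t; rewrite !lt_min => /andP[/andP[q1 q2] q3] /andP[/andP[t1 t2] t3].
have tv : `|t *: v| < d2 / 2.
  rewrite normrZ; move: t3; rewrite ltr_pdivlMr// mulrDr mulr1.
  by have := normr_ge0 t; lra.
have q3' : `|q - p| < d2 / 2.
  apply: lt_le_trans q3 _; rewrite ler_pdivrMr// ler_peMr//; first lra.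
  by rewrite lerDl.
have := H1 _ _ q1 t1; have := H2 (q + t *: v) t _ t2.
rewrite scalerDr addrA => /(_ _) A B.
have -> : f (q + t *: v + t *: w) - f q - t * (L + M) =
  (f (q + t *: v + t *: w) - f (q + t *: v) - t * M) +
  (f (q + t *: v) - f q - t * L) by ring.
apply: le_trans (ler_normD _ _) _.
have -> : e * `|t| = e / 2 * `|t| + e / 2 * `|t| by lra.
apply: lerD => //; apply: A; rewrite addrAC.
by apply: le_lt_trans (ler_normD _ _) _; lra.
Qed.

Lemma strict_deriveZ (R : realType) (n : nat) (f : 'rV[R]_n -> R) p v L c :
  strict_derive f p v L -> strict_derive f p (c *: v) (c * L).
Proof.
move=> fv e e0; have c1 : 0 < 1 + `|c| by rewrite ltr_wpDr.
have [d d0 H] := fv (e / (1 + `|c|)) (divr_gt0 e0 c1).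
exists (Num.min d (d / (1 + `|c|))); first by rewrite lt_min d0 divr_gt0.
move=> q t; rewrite !lt_min => /andP[q1 q2] /andP[t1 t2].
have tc : `|t * c| < d.
  rewrite normrM; move: t2; rewrite ltr_pdivlMr// mulrDr mulr1.
  by have := normr_ge0 t; lra.
rewrite scalerA mulrA; apply: le_trans (H _ _ q1 tc) _.
rewrite normrM mulrCA [leRHS]mulrC ler_wpM2l// mulrC mulrA ler_pdivrMr//.
by have := normr_ge0 c; nra.
Qed.

Lemma strict_derive_is_derive (R : realType) (n : nat) (f : 'rV[R]_n -> R)
  p v L : strict_derive f p v L -> is_derive p v f L.
Proof.
move=> fv.
have C : (fun h : R => h^-1 *: ((f \o shift p) (h *: v) - f p)) @ 0^' --> L.
  apply/cvgrPdist_le => e e0; have [d d0 H] := fv e e0.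
  apply/nbhs_ballP; exists d => //= t; rewrite /ball /= sub0r normrN => td t0.
  have Ht : `|f (p + t *: v) - f p - t * L| <= e * `|t|.
    by apply: H => //; rewrite subrr normr0.
  rewrite distrC /= [t *: v + p]addrC.
  have -> : t^-1 *: (f (p + t *: v) - f p) - L =
     t^-1 * (f (p + t *: v) - f p - t * L).
    by rewrite [RHS]mulrBr mulKf.
  by rewrite normrM normfV mulrC ler_pdivrMr// normr_gt0.
by split; [apply/cvg_ex; exists L | exact: cvg_lim C].
Qed.

Lemma strict_derive_partial (R : realType) (n : nat) (f : 'rV[R]_n -> R) p
  (i : 'I_n) :
  (\forall q \near p, derivable f q (delta_mx 0 i)) ->
  {for p, continuous (partial i f)} ->
  strict_derive f p (delta_mx 0 i) (partial i f p).
Proof.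
move=> df cf e e0.
have [d d0 Hd] : exists2 d : R, 0 < d & forall q, `|q - p| < d ->
    derivable f q (delta_mx 0 i) /\ `|partial i f q - partial i f p| <= e.
  move/cvgrPdist_le : cf => /(_ _ e0) cf.
  have /nbhs_ballP[d /= d0 Hd] : \forall q \near p, derivable f q (delta_mx 0 i)
      /\ `|partial i f q - partial i f p| <= e.
    by near=> q; split; last rewrite distrC; near: q.
  by exists d => // q qd; apply: Hd; rewrite -ball_normE /= distrC.
exists (d / 2); first by lra.
move=> q t qd td; set v := delta_mx 0 i.
have nv x : `|x *: v| <= `|x|.
  rewrite normrZ ler_piMr// [leLHS]mx_normrE; apply: bigmax_le => // -[a b] _ /=.
  by rewrite mxE; case: (_ && _); rewrite ?normr1// normr0.
have near_p x : `|x| <= `|t| -> `|q + x *: v - p| < d.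
  move=> xt; rewrite addrAC; apply: le_lt_trans (ler_normD _ _) _.
  by have := nv x; lra.
have dl x : `|x| <= `|t| ->
    is_derive x (1 : R) (fun x : R => f (q + x *: v)) (partial i f (q + x *: v)).
  move=> xt; apply/is_derive_lineP/derivableP.
  by have [] := Hd _ (near_p _ xt).
have [x xt E] : exists2 x, `|x| <= `|t| &
    f (q + t *: v) - f q = t * partial i f (q + x *: v).
  case: (ltrgtP t 0) => [t0|t0|->]; last first.
  - by exists 0 => //; rewrite scale0r addr0 subrr mul0r.
  - have [x||x] := @MVT _ (fun x => f (q + x *: v))
      (fun x => partial i f (q + x *: v)) 0 t t0.
    + rewrite in_itv /= => /andP[x0 xt]; apply: dl.
      by rewrite !gtr0_norm// ltW.
    + apply: derivable_within_continuous => x; rewrite in_itv /= => /andP[x0 xt].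
      by have [] // := dl x _; rewrite !ger0_norm// ltW.
    rewrite in_itv /= => /andP[x0 xt].
    rewrite scale0r addr0 subr0 mulrC => E.
    by exists x => //; rewrite !ger0_norm// ltW.
  - have [x||x] := @MVT _ (fun x => f (q + x *: v))
      (fun x => partial i f (q + x *: v)) t 0 t0.
    + rewrite in_itv /= => /andP[x0 xt]; apply: dl.
      by rewrite !ltr0_norm// lerN2 ltW.
    + apply: derivable_within_continuous => x; rewrite in_itv /= => /andP[x0 xt].
      by have [] // := dl x _; rewrite (ltr0_norm t0) ler0_norm// lerN2.
    rewrite in_itv /= => /andP[x0 xt].
    rewrite scale0r addr0 => E.
    exists x; first by rewrite !ltr0_norm// lerN2 ltW.
    by rewrite -opprB E sub0r mulrN opprK mulrC.
rewrite E -mulrBr normrM mulrC ler_wpM2r//.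
by have [] := Hd _ (near_p _ xt).
Unshelve. all: by end_near. Qed.

(** A function with continuous partial derivatives is derivable along every
    direction, and the directional derivative is linear in the direction. *)
Lemma is_derive_partials (R : realType) (n : nat) (f : 'rV[R]_n -> R)
  (D : set 'rV[R]_n) (p b : 'rV[R]_n) :
  nbhs p D -> C1_on D f -> is_derive p b f (\sum_(i < n) b 0 i * partial i f p).
Proof.
move=> Dp fD; apply: strict_derive_is_derive.
(* [b] is a combination of coordinate directions, each handled by the mean
   value theorem. *)
rewrite {1}[b]row_sum_delta.
elim/big_ind2 : _ => [|x1 x2 y1 y2|i _].
- exact: strict_derive0.
- exact: strict_deriveD.
apply/strict_deriveZ/strict_derive_partial.
- by near=> q; apply: (fD i q _).1; near: q.
- by apply: (fD i p _).2; exact: nbhs_singleton.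
Unshelve. all: by end_near. Qed.

(** * Quadratic forms and the barrier identity *)

Lemma dot_mulmx (R : realType) (n : nat) (p q : 'rV[R]_n) :
  p *m q^T = (dot p q)%:M.
Proof.
apply/matrixP => i j; rewrite !ord1 !mxE eqxx mulr1n.
by apply: eq_bigr => k _; rewrite mxE.
Qed.

Lemma dot_mulmx_sqr (R : realType) (n : nat) (p q : 'rV[R]_n) :
  q *m (p^T *m p) *m q^T = (dot p q ^+ 2)%:M.
Proof.
rewrite mulmxA -[_ *m _ *m _]mulmxA !dot_mulmx -scalar_mxM; congr _%:M.
by rewrite expr2; congr (_ * _); apply: eq_bigr => i _; rewrite mulrC.
Qed.

Lemma dot_ge0 (R : realType) (n : nat) (p : 'rV[R]_n) : 0 <= dot p p.
Proof. by apply: sumr_ge0 => i _; rewrite -expr2 sqr_ge0. Qed.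

(** If the quadratic form [N] is nonpositive, then [tr (A N) <= 0] for the
    positive semidefinite matrix [A = 1 - a p^T p]: the proof writes [A] as
    [B^T B] with [B] of the same shape. *)
Lemma trace_rank1_le (R : realType) (n : nat) (N : 'M[R]_n) (p : 'rV[R]_n)
  (a : R) :
  (forall b : 'rV[R]_n, (b *m N *m b^T) 0 0 <= 0) ->
  0 < dot p p -> a * dot p p <= 1 -> \tr N <= a * (p *m N *m p^T) 0 0.
Proof.
move=> N_le0 s0 as1; set s := dot p p in s0 as1.
pose k := (1 - Num.sqrt (1 - a * s)) / s.
have ka : 2 * k - k ^+ 2 * s = a.
  have : Num.sqrt (1 - a * s) ^+ 2 = 1 - a * s by rewrite sqr_sqrtr// subr_ge0.
  rewrite /k; move: (Num.sqrt _) => x x2.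
  have -> : 2 * ((1 - x) / s) - ((1 - x) / s) ^+ 2 * s = (1 - x ^+ 2) / s.
    by field; rewrite gt_eqF.
  by rewrite x2 opprB addrC subrK mulfK// gt_eqF.
pose B : 'M[R]_n := 1%:M - k *: (p^T *m p).
have BT : B^T = B.
  by rewrite /B linearB linearZ /= trmx1 trmx_mul trmxK.
have BB : B^T *m B = 1%:M - a *: (p^T *m p).
  rewrite BT /B mulmxBl !mulmxBr !mul1mx mulmx1 -scalemxAl -scalemxAr.
  rewrite mulmxA -[p^T *m p *m p^T]mulmxA dot_mulmx -/s mul_mx_scalar -scalemxAl.
  rewrite -ka !scalerA opprB scalerBl mulr_natl mulr2n scalerDl.
  by rewrite expr2 !opprD !addrA opprK [RHS]addrAC mulrA.
have trB : \tr (B *m N *m B^T) <= 0.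
  apply: sumr_le0 => i _.
  have := N_le0 (row i B).
  rewrite -row_mul; congr (_ <= 0); rewrite [LHS]mxE [RHS]mxE.
  apply: eq_bigr => j _.
  rewrite [row i _ _ _]mxE [_^T j _]mxE [row i _ _ _]mxE [RHS]mulrC mulrC.
  by rewrite [_^T j i]mxE.
rewrite mxtrace_mulC mulmxA BB mulmxBl mul1mx -scalemxAl linearB linearZ /= in trB.
move: trB; rewrite -[p^T *m p *m N]mulmxA [\tr (p^T *m _)]mxtrace_mulC.
by rewrite [\tr (p *m N *m _)]big_ord_recl big_ord0 addr0 subr_le0.
Qed.

(** The excess of the barrier.  At a point where the gradient of [u] is
    [- mu p], with [T] the tangent of [dl + m u], the second derivative test
    bounds the Hessian of [u] by the form [al p^T p - be 1]; the first two
    terms are the trace of the latter against [1 - a p^T p], and the subtracted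
    ones are the value that the equation imposes on the trace of the Hessian
    against the same matrix. *)
Lemma barrier_identity (R : realType) (n s T : R) :
  let F := ((1 - s) / 2) ^+ 2 in
  let mu := 4 * T / (1 - s ^+ 2) in
  let t2 := 1 + F * (mu ^+ 2 * s) in
  let a := F * mu ^+ 2 / t2 in
  let al := T * (16 * ((n - 1) * (1 + T ^+ 2) - s) / (1 - s ^+ 2) ^+ 2) in
  let be := T * (4 / (1 - s ^+ 2)) in
  0 <= s -> s < 1 ->
  al * (s * (1 - a * s)) - be * (n - a * s)
  - ((1 - s) * mu ^+ 3 * s ^+ 2 / (2 * t2) + 2 * (n - 2) * mu * s / (1 - s))
  = - (4 * n * T / (t2 * (1 + s) ^+ 2)).
Proof.
move=> F mu t2 a al be s0 s1; rewrite /al /be /a.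
have t20 : t2 != 0.
  by rewrite gt_eqF// ltr_wpDr// mulr_ge0 ?sqr_ge0// mulr_ge0 ?sqr_ge0.
rewrite /t2 in t20 *; rewrite /F /mu in t20 *.
have h1 : 1 - s != 0 by rewrite gt_eqF// subr_gt0.
have h2 : 1 + s != 0 by rewrite gt_eqF// ltr_wpDr.
have E : 1 - s ^+ 2 = (1 - s) * (1 + s) by ring.
rewrite E in t20 *.
have E2 : 1 + ((1 - s) / 2) ^+ 2 * ((4 * T / ((1 - s) * (1 + s))) ^+ 2 * s) =
  ((1 + s) ^+ 2 + 4 * s * T ^+ 2) / (1 + s) ^+ 2 by field; rewrite h1 h2.
have h3 : (1 + s) ^+ 2 + 4 * s * T ^+ 2 != 0.
  by apply: contraNneq t20; rewrite E2 => ->; rewrite mul0r.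
rewrite E2; field; rewrite ?h1 ?h2 ?h3 //=.
Qed.

(** * Differentiation rules for real functions given by abstractions *)

Section LambdaDerive.
Variable R : realType.
Implicit Types (f g : R -> R) (x a b : R).

Lemma dfun_add f g x a b : is_derive x 1 f a -> is_derive x 1 g b ->
  is_derive x 1 (fun y => f y + g y) (a + b).
Proof. by move=> ? ?; apply: is_deriveD. Qed.

Lemma dfun_sub f g x a b : is_derive x 1 f a -> is_derive x 1 g b ->
  is_derive x 1 (fun y => f y - g y) (a - b).
Proof. by move=> ? ?; apply: is_deriveB. Qed.

Lemma dfun_mul f g x a b : is_derive x 1 f a -> is_derive x 1 g b ->
  is_derive x 1 (fun y => f y * g y) (f x * b + g x * a).
Proof. by move=> ? ?; apply: is_deriveM. Qed.

Lemma dfun_scale f x a k : is_derive x 1 f a ->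
  is_derive x 1 (fun y => k * f y) (k * a).
Proof. by move=> ?; apply: is_deriveZ. Qed.

Lemma dfun_cst k x : is_derive x 1 (fun=> k : R) 0.
Proof. exact: is_derive_cst. Qed.

Lemma dfun_id x : is_derive x 1 (fun y : R => y) 1.
Proof. exact: is_derive_id. Qed.

Lemma dfun_sqr f x a : is_derive x 1 f a ->
  is_derive x 1 (fun y => f y ^+ 2) (2 * f x * a).
Proof. 
move=> fa; rewrite (_ : (fun y => _) = fun y => f y * f y) //.
apply: (is_derive_eq (dfun_mul fa fa)).
by rewrite mulr_natl mulrnAl mulr2n.
 Qed.

Lemma dfun_inv f x a : f x != 0 -> is_derive x 1 f a ->
  is_derive x 1 (fun y => (f y)^-1) (- a / f x ^+ 2).
Proof.
move=> f0 fa; apply: (is_derive_eq (is_deriveV f0 fa)).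
by rewrite /GRing.scale /= !mulNr mulrC.
Qed.

Lemma dfun_sqrt f x a : 0 < f x -> is_derive x 1 f a ->
  is_derive x 1 (fun y => Num.sqrt (f y)) (a / (2 * Num.sqrt (f x))).
Proof.
move=> f0 fa; rewrite mulrC.
by apply: (is_derive1_comp (is_derive1_sqrt f0) fa).
Qed.

Lemma dfun_ln f x a : 0 < f x -> is_derive x 1 f a ->
  is_derive x 1 (fun y => ln (f y)) (a / f x).
Proof.
move=> f0 fa; rewrite mulrC.
by apply: (is_derive1_comp (is_derive1_ln f0) fa).
Qed.

Lemma dfun_sin f x a : is_derive x 1 f a ->
  is_derive x 1 (fun y => sin (f y)) (cos (f x) * a).
Proof. by move=> fa; apply: (is_derive1_comp (is_derive_sin _) fa). Qed.

Lemma dfun_cos f x a : is_derive x 1 f a ->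
  is_derive x 1 (fun y => cos (f y)) (- sin (f x) * a).
Proof. by move=> fa; apply: (is_derive1_comp (is_derive_cos _) fa). Qed.

Lemma dfun_sum n (h : 'I_n -> R -> R) x (a : 'I_n -> R) :
  (forall i, is_derive x 1 (h i) (a i)) ->
  is_derive x 1 (fun y => \sum_(i < n) h i y) (\sum_(i < n) a i).
Proof.
move=> ha; have := is_derive_sum ha.
by congr is_derive; apply/funext => y; rewrite fct_sumE.
Qed.

End LambdaDerive.

(** * The minimal graph equation *)

Lemma dot_line (R : realType) (n : nat) (p b : 'rV[R]_n) (x : R) :
  dot (p + x *: b) (p + x *: b) = dot p p + 2 * x * dot p b + x ^+ 2 * dot b b.
Proof.
rewrite /dot !mulr_sumr -!big_split /=; apply: eq_bigr => i _.
by rewrite !mxE; ring.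
Qed.

Lemma enorm_sqr (R : realType) (n : nat) (p : 'rV[R]_n) :
  enorm p ^+ 2 = dot p p.
Proof. by rewrite sqr_sqrtr// dot_ge0. Qed.

Lemma dot_delta (R : realType) (n : nat) (p : 'rV[R]_n) (i : 'I_n) :
  dot p (delta_mx 0 i) = p 0 i.
Proof.
rewrite /dot (bigD1 i)//= mxE !eqxx mulr1 big1 ?addr0// => j ji.
by rewrite mxE (negPf ji) andbF mulr0.
Qed.

Lemma is_derive_confF (R : realType) (n : nat) (p b : 'rV[R]_n) :
  is_derive (0 : R) 1 (fun x : R => confF (p + x *: b))
    (- (1 - dot p p) * dot p b).
Proof.
rewrite (_ : (fun x => _) = fun x : R =>
  ((1 - (dot p p + 2 * dot p b * x + dot b b * x ^+ 2)) * 2^-1) ^+ 2); last first.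
  apply/funext => x; rewrite /confF enorm_sqr dot_line; congr (((1 - _) / 2) ^+ 2).
  by ring.
apply: (is_derive_eq (dfun_sqr (dfun_mul (dfun_sub (dfun_cst _ _)
  (dfun_add (dfun_add (dfun_cst _ _) (dfun_scale _ (dfun_id _)))
            (dfun_scale _ (dfun_sqr (dfun_id _))))) (dfun_cst _ _)))).
by rewrite /=; field.
Qed.

(** The second derivatives of [u] at [p]. *)
Definition hessian (R : realType) (n : nat) (u : 'rV[R]_n -> R)
  (p : 'rV[R]_n) : 'M[R]_n :=
  \matrix_(i < n, j < n) partial i (partial j u) p.

Lemma mulmx_quad (R : realType) (n : nat) (N : 'M[R]_n) (b : 'rV[R]_n) :
  (b *m N *m b^T) 0 0 = \sum_(i < n) \sum_(j < n) b 0 i * b 0 j * N i j.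
Proof.
rewrite mxE exchange_big /=; apply: eq_bigr => j _.
rewrite mxE mulr_suml; apply: eq_bigr => i _; rewrite [_^T j 0]mxE; ring.
Qed.

(** Expanded form of the minimal graph equation, multiplied by [tau u p]. *)
Lemma minimal_graph_expand (R : realType) (n : nat) (u : 'rV[R]_n -> R)
  (D : set 'rV[R]_n) (p : 'rV[R]_n) :
  C2_on D u -> D p -> dot p p < 1 -> minimal_graph_equation u p ->
  let v := grad u p in
  let t2 := 1 + ((1 - dot p p) / 2) ^+ 2 * dot v v in
  \tr (hessian u p)
  - ((1 - dot p p) / 2) ^+ 2 / t2 * (v *m hessian u p *m v^T) 0 0
  + (1 - dot p p) * dot v v * dot p v / (2 * t2)
  + 2 * (n%:R - 2) * dot p v / (1 - dot p p) = 0.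
Proof.
move=> [C1 C2] Dp s1 ueq v t2; set s := dot p p in s1 t2 *.
have tauE q : tau u q = Num.sqrt (1 + confF q * \sum_(j < n) partial j u q ^+ 2).
  rewrite /tau enorm_sqr; congr (Num.sqrt (1 + _ * _)).
  by apply: eq_bigr => j _; rewrite mxE expr2.
have vvE : \sum_(j < n) partial j u p ^+ 2 = dot v v.
  by apply: eq_bigr => j _; rewrite mxE expr2.
have confE : confF p = ((1 - s) / 2) ^+ 2 by rewrite /confF enorm_sqr.
have t20 : 0 < t2 by rewrite ltr_wpDr// mulr_ge0 ?sqr_ge0// dot_ge0.
have taut2 : tau u p = Num.sqrt t2 by rewrite tauE vvE confE.
have tau0 : 0 < tau u p by rewrite taut2 sqrtr_gt0.
have tau2 : tau u p ^+ 2 = t2 by rewrite taut2 sqr_sqrtr// ltW.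
have sqF : Num.sqrt (confF p) = (1 - s) / 2.
  by rewrite confE sqrtr_sqr ger0_norm//; lra.
have wder i j : is_derive (0 : R) 1
    (fun x : R => partial j u (p + x *: delta_mx 0 i)) (hessian u p i j).
  apply/is_derive_lineP; rewrite scale0r addr0 mxE; apply: derivableP.
  by have [] := C2 j i p Dp.
have divE i : partial i (fun q => ((tau u q)^-1 *: grad u q) 0 i) p =
    (tau u p)^-1 * (hessian u p i i - v 0 i / t2 *
      (- (1 - s) * p 0 i * dot v v / 2
       + ((1 - s) / 2) ^+ 2 * \sum_(j < n) v 0 j * hessian u p i j)).
  rewrite /partial.
  have p0 : p + (0 : R) *: delta_mx 0 i = p by rewrite scale0r addr0.
  have : is_derive (p + (0 : R) *: delta_mx 0 i) (delta_mx 0 i)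
    (fun q => ((tau u q)^-1 *: grad u q) 0 i)
    ((tau u p)^-1 * (hessian u p i i - v 0 i / t2 *
      (- (1 - s) * p 0 i * dot v v / 2
       + ((1 - s) / 2) ^+ 2 * \sum_(j < n) v 0 j * hessian u p i j))).
    apply/is_derive_lineP; rewrite (_ : (fun x => _) = fun x : R =>
      (Num.sqrt (1 + confF (p + x *: delta_mx 0 i) *
         \sum_(j < n) partial j u (p + x *: delta_mx 0 i) ^+ 2))^-1 *
      partial i u (p + x *: delta_mx 0 i)); last first.
      by apply/funext => x; rewrite !mxE tauE.
    have Dt := dfun_add (dfun_cst 1 0) (dfun_mul
      (is_derive_confF p (delta_mx 0 i))
      (dfun_sum (fun j => dfun_sqr (wder i j)))).
    pose W (x : R) := 1 + confF (p + x *: delta_mx 0 i) *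
        \sum_(j < n) partial j u (p + x *: delta_mx 0 i) ^+ 2.
    have W0 : 0 < W 0 by rewrite /W p0 vvE confE.
    have sW0 : Num.sqrt (W 0) != 0 by rewrite gt_eqF// sqrtr_gt0.
    have Dsq := @dfun_inv _ (fun x => Num.sqrt (W x)) _ _ sW0
      (@dfun_sqrt _ W _ _ W0 Dt).
    apply: (is_derive_eq (dfun_mul Dsq (wder i i))).
    rewrite /W.
    rewrite /= !p0 vvE confE -/t2 -taut2 dot_delta -/s.
    have -> : \sum_(j < n) 2 * partial j u p * hessian u p i j =
        2 * \sum_(j < n) v 0 j * hessian u p i j.
      by rewrite mulr_sumr; apply: eq_bigr => j _; rewrite !mxE mulrA.
    have -> : partial i u p = v 0 i by rewrite mxE.
    rewrite -tau2; field; rewrite gt_eqF//.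
  by rewrite p0 => -[].
move: ueq; rewrite /minimal_graph_equation /divergence.
under eq_bigr do rewrite divE.
rewrite -mulr_sumr sumrB sqF -/v => ueq.
have E : \sum_(i < n) v 0 i / t2 *
      (- (1 - s) * p 0 i * dot v v / 2
       + ((1 - s) / 2) ^+ 2 * \sum_(j < n) v 0 j * hessian u p i j) =
   ((1 - s) / 2) ^+ 2 / t2 * (v *m hessian u p *m v^T) 0 0
   - (1 - s) * dot v v * dot p v / (2 * t2).
  rewrite (_ : (v *m _ *m _) 0 0 =
    \sum_(i < n) v 0 i * \sum_(j < n) v 0 j * hessian u p i j); last first.
    rewrite mulmx_quad; apply: eq_bigr => i _.
    by rewrite mulr_sumr; apply: eq_bigr => j _; rewrite mulrA.
  rewrite (_ : (1 - s) * dot v v * dot p v / (2 * t2) =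
    (1 - s) * dot v v / (2 * t2) * dot p v); last by rewrite mulrAC.
  rewrite [dot p v]/dot [X in _ = _ - X]mulr_sumr
    [X in _ = X - _]mulr_sumr -sumrB; apply: eq_bigr => i _.
  by field; rewrite gt_eqF.
rewrite E in ueq.
have := congr1 ( *%R (tau u p)) ueq.
rewrite mulr0 mulrDr mulrA divff ?gt_eqF// mul1r => <-.
rewrite opprB !addrA -/(\tr (hessian u p)).
congr (_ + _).
  by rewrite addrAC.
field; rewrite (gt_eqF tau0) gt_eqF//; lra.
Qed.

(** * Touching the barrier from below *)

Lemma is_derive_near_gt (R : realType) (f : R -> R) (d y : R) :
  is_derive (0 : R) 1 f d -> y < f 0 -> \forall t \near (0 : R), y < f t.
Proof.
move=> [fd _] y0.
have fc : {for (0 : R), continuous f}.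
  exact/differentiable_continuous/derivable1_diffP.
exact: (cvgr_gt _ fc _ y0).
Qed.

(** First and second order conditions at a maximum, along a line, of
    [ln (sin (dl + m u)) + m ln lambda].  [U] is the restriction of [u] to the
    line, [U1] and [U2] its derivatives, and [S] that of [|p|^2]; [K] is the
    cotangent of [dl + m u]. *)
Lemma barrier_line_max (R : realType) (U U1 : R -> R) (U2 a c s dl m : R) :
  0 < m -> 0 <= s -> s < 1 ->
  (\forall t \near (0 : R), is_derive t (1 : R) U (U1 t)) ->
  is_derive (0 : R) 1 U1 U2 ->
  0 < sin (dl + m * U 0) ->
  let S (t : R) := s + 2 * t * a + t ^+ 2 * c in
  let f (t : R) := ln (sin (dl + m * U t)) + m * (ln (1 + S t) - ln (1 - S t)) in
  (\forall t \near (0 : R), f t <= f 0) ->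
  let K := cos (dl + m * U 0) / sin (dl + m * U 0) in
  K * U1 0 + 4 * a / (1 - s ^+ 2) = 0 /\
  K * U2 <= m * (1 + K ^+ 2) * U1 0 ^+ 2 - 4 * c / (1 - s ^+ 2)
            - 16 * s * a ^+ 2 / (1 - s ^+ 2) ^+ 2.
Proof.
move=> m0 s0 s1 dU dU1 sin0 S f fmax K.
pose th t := dl + m * U t.
pose S1 t := 2 * a + 2 * t * c.
pose g t := cos (th t) / sin (th t) * (m * U1 t) +
            m * (S1 t / (1 + S t) + S1 t / (1 - S t)).
have SE : S = fun t => s + 2 * a * t + c * t ^+ 2.
  by apply/funext => t; rewrite /S; ring.
have dS (t : R) : is_derive t (1 : R) S (S1 t).
  rewrite SE; apply: (is_derive_eq (dfun_add (dfun_add (dfun_cst s t)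
    (dfun_scale (2 * a) (dfun_id t)))
    (dfun_scale c (dfun_sqr (dfun_id t))))).
  by rewrite /S1; ring.
have dS1 (t : R) : is_derive t (1 : R) S1 (2 * c).
  rewrite (_ : S1 = fun t => 2 * a + 2 * c * t); last first.
    by apply/funext => x; rewrite /S1; ring.
  apply: (is_derive_eq (dfun_add (dfun_cst (2 * a) t)
    (dfun_scale (2 * c) (dfun_id t)))).
  by ring.
have dU0 : is_derive (0 : R) 1 U (U1 0) by exact: nbhs_singleton dU.
have dth (t : R) :
    is_derive t (1 : R) U (U1 t) -> is_derive t (1 : R) th (m * U1 t).
  move=> h; apply: (is_derive_eq (dfun_add (dfun_cst dl t) (dfun_scale m h))).
  by rewrite add0r.
have S00 : S 0 = s by rewrite /S; ring.
have S10 : S1 0 = 2 * a by rewrite /S1; ring.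
have near1 : \forall t \near (0 : R), 0 < sin (th t).
  by apply: is_derive_near_gt sin0; exact: (dfun_sin (dth _ dU0)).
have d1 (t : R) : is_derive t (1 : R) (fun t => 1 + S t) (S1 t).
  by apply: (is_derive_eq (dfun_add (dfun_cst 1 t) (dS t))); rewrite add0r.
have d2 (t : R) : is_derive t (1 : R) (fun t => 1 - S t) (- S1 t).
  by apply: (is_derive_eq (dfun_sub (dfun_cst 1 t) (dS t))); rewrite sub0r.
have near2 : \forall t \near (0 : R), 0 < 1 + S t.
  by apply: (is_derive_near_gt (d1 0)); rewrite S00 ltr_wpDr.
have near3 : \forall t \near (0 : R), 0 < 1 - S t.
  by apply: (is_derive_near_gt (d2 0)); rewrite S00 subr_gt0.
have p1 : 0 < 1 + S 0 by rewrite S00 ltr_wpDr.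
have p2 : 0 < 1 - S 0 by rewrite S00 subr_gt0.
have df : \forall t \near (0 : R), is_derive t (1 : R) f (g t).
  near=> t.
  have q1 : 0 < sin (th t) by near: t.
  have q2 : 0 < 1 + S t by near: t.
  have q3 : 0 < 1 - S t by near: t.
  have dUt : is_derive t (1 : R) U (U1 t) by near: t.
  have l1 := @dfun_ln _ (fun t => sin (th t)) _ _ q1 (dfun_sin (dth _ dUt)).
  have l2 := @dfun_ln _ (fun t => 1 + S t) _ _ q2 (d1 t).
  have l3 := @dfun_ln _ (fun t => 1 - S t) _ _ q3 (d2 t).
  apply: (is_derive_eq (dfun_add l1 (dfun_scale m (dfun_sub l2 l3)))).
  by rewrite /g; field; rewrite !gt_eqF.
have sn0 : sin (th 0) != 0 by rewrite gt_eqF.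
have dg : is_derive (0 : R) 1 g
   (- (1 + K ^+ 2) * m ^+ 2 * U1 0 ^+ 2 + K * m * U2
    + m * (4 * c / (1 - s ^+ 2) + 16 * s * a ^+ 2 / (1 - s ^+ 2) ^+ 2)).
  have e1 := dfun_mul (dfun_cos (dth _ dU0))
    (@dfun_inv _ (fun t => sin (th t)) _ _ sn0 (dfun_sin (dth _ dU0))).
  have e2 := dfun_mul e1 (dfun_scale m dU1).
  have e3 := dfun_mul (dS1 0)
    (@dfun_inv _ (fun t => 1 + S t) _ _ (lt0r_neq0 p1) (d1 0)).
  have e4 := dfun_mul (dS1 0)
    (@dfun_inv _ (fun t => 1 - S t) _ _ (lt0r_neq0 p2) (d2 0)).
  apply: (is_derive_eq (dfun_add e2 (dfun_scale m (dfun_add e3 e4)))).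
  rewrite S00 S10 /K.
  have E : 1 - s ^+ 2 = (1 - s) * (1 + s) by ring.
  rewrite E; field.
  by rewrite sn0 !gt_eqF//; lra.
have [g0 c0] := second_derivative_test df dg fmax.
have E : 1 - s ^+ 2 = (1 - s) * (1 + s) by ring.
split.
  apply: (mulfI (lt0r_neq0 m0)); rewrite mulr0; apply: etrans g0.
  rewrite /g S00 S10 E -/K.
  by rewrite /K -/(th 0); field; rewrite sn0 !gt_eqF//; lra.
have h2 : m * (K * U2 - (m * (1 + K ^+ 2) * U1 0 ^+ 2 - 4 * c / (1 - s ^+ 2)
            - 16 * s * a ^+ 2 / (1 - s ^+ 2) ^+ 2)) <= 0.
  apply: le_trans c0; rewrite le_eqVlt; apply/orP; left; apply/eqP; ring.
by rewrite -subr_le0; move: h2; rewrite pmulr_rle0.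
Unshelve. all: by end_near. Qed.

(** A minimal graph cannot touch from below, at an interior point, a barrier
    translated vertically by [- dl / m]: over a point [q], the height [z] of
    such a translate satisfies
    [ln (sin (dl + m z)) + m ln lambda (q) = const], so that a local maximum
    of [f] is a point where it is touched by the graph. *)
Lemma no_touching (R : realType) (n : nat) (u : 'rV[R]_n -> R)
  (D : set 'rV[R]_n) (p : 'rV[R]_n) (dl : R) :
  (1 < n)%N -> nbhs p D -> C2_on D u -> minimal_graph_equation u p ->
  0 < dot p p -> dot p p < 1 ->
  let m := n%:R - 1 in
  let th := dl + m * u p in
  0 < th -> th <= pi / 2 ->
  let f (q : 'rV[R]_n) :=
    ln (sin (dl + m * u q)) + m * (ln (1 + dot q q) - ln (1 - dot q q)) in
  (\forall q \near p, f q <= f p) -> False.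
Proof.
move=> n1 pD C2u ueq s0 s1 m th th0 thpi f fmax.
set s := dot p p in s0 s1.
have m0 : 0 < m by rewrite subr_gt0 ltr1n.
have sin0 : 0 < sin th.
  apply: sin_gt0_pi; rewrite th0 /=; apply: le_lt_trans thpi _.
  by have := pi_gt0 R; lra.
pose K := cos th / sin th.
have Kge : 0 <= K.
  rewrite divr_ge0 ?(ltW sin0)// cos_ge0_pihalf// thpi andbT.
  by have := pi_gt0 R; lra.
pose Q (b : 'rV[R]_n) : R := (b *m hessian u p *m b^T) 0 0.
pose v := grad u p.
have line (b : 'rV[R]_n) : forall P : set 'rV[R]_n, nbhs p P ->
    \forall t \near (0 : R), P (p + t *: b).
  move=> P pP.
  have c : p + t *: b @[t --> (0 : R)] --> p + (0 : R) *: b.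
    by apply: cvgD; [exact: cvg_cst | apply: cvgZr_tmp; exact: cvg_id].
  by apply: c; rewrite scale0r addr0.
have key (b : 'rV[R]_n) :
  K * dot b v + 4 * dot p b / (1 - s ^+ 2) = 0 /\
  K * Q b <= m * (1 + K ^+ 2) * dot b v ^+ 2 - 4 * dot b b / (1 - s ^+ 2)
            - 16 * s * dot p b ^+ 2 / (1 - s ^+ 2) ^+ 2.
  pose U (t : R) := u (p + t *: b).
  pose U1 (t : R) := \sum_(i < n) b 0 i * partial i u (p + t *: b).
  have U0 : U 0 = u p by rewrite /U scale0r addr0.
  have U10 : U1 0 = dot b v.
    by apply: eq_bigr => i _; rewrite scale0r addr0 mxE.
  have dU : \forall t \near (0 : R), is_derive t (1 : R) U (U1 t).
    have := line b _ (nbhs_interior pD); apply: filterS => t pt.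
    by apply/is_derive_lineP; apply: is_derive_partials pt _; exact: C2u.1.
  have dU1 : is_derive (0 : R) 1 U1 (Q b).
    have pD0 : nbhs (p + (0 : R) *: b) D by rewrite scale0r addr0.
    have dj j : is_derive (0 : R) 1 (fun t : R => partial j u (p + t *: b))
        (\sum_(i < n) b 0 i * hessian u p i j).
      apply/is_derive_lineP.
      apply: (is_derive_eq (is_derive_partials b pD0 (C2u.2 j))).
      by apply: eq_bigr => i _; rewrite scale0r addr0 mxE.
    apply: (is_derive_eq (dfun_sum (fun j => dfun_scale (b 0 j) (dj j)))).
    rewrite /Q mulmx_quad exchange_big /=; apply: eq_bigr => j _.
    by rewrite mulr_sumr; apply: eq_bigr => i _; rewrite mulrCA mulrA.
  have := @barrier_line_max R U U1 (Q b) (dot p b) (dot b b) s dl m m0 (ltW s0)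
    s1 dU dU1.
  rewrite U0 -/th U10; apply=> //.
  have := line b _ fmax; apply: filterS => t.
  by rewrite /f /U dot_line -/s mulr0 mul0r expr0n /= mul0r !addr0 scale0r addr0.
(* The radial first order condition excludes a vertical tangent plane. *)
have K0 : 0 < K.
  rewrite lt_neqAle Kge andbT; apply/negP => /eqP K0.
  have [/eqP + _] := key p; rewrite -K0 mul0r add0r -/s => /eqP.
  apply/eqP; rewrite mulf_neq0 ?invr_neq0 ?mulf_neq0 ?gt_eqF//.
  by rewrite subr_gt0 expr_lt1// ltW.
have s21 : 0 < 1 - s ^+ 2 by rewrite subr_gt0 expr_lt1// ltW.
pose T := K^-1; pose mu := 4 * T / (1 - s ^+ 2).
have vE : v = - mu *: p.
  apply/rowP => i; rewrite [RHS]mxE.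
  have [+ _] := key (delta_mx 0 i); rewrite dot_delta.
  rewrite (_ : dot _ v = v 0 i); last first.
    by rewrite -(dot_delta v i); apply: eq_bigr => j _; rewrite mulrC.
  move=> /eqP; rewrite addr_eq0 => /eqP e.
  apply: (mulfI (lt0r_neq0 K0)); rewrite e /mu /T; field.
  by rewrite !gt_eqF.
have bvE b : dot b v = - mu * dot p b.
  rewrite vE /dot mulr_sumr; apply: eq_bigr => i _; rewrite mxE; ring.
pose al := T * (16 * (m * (1 + T ^+ 2) - s) / (1 - s ^+ 2) ^+ 2).
pose be := T * (4 / (1 - s ^+ 2)).
have T0 : 0 < T by rewrite invr_gt0.
have Qle b : Q b - al * dot p b ^+ 2 + be * dot b b <= 0.
  have [_] := key b; rewrite bvE => h.
  have {}h := ler_wpM2l (ltW T0) h.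
  rewrite mulrA [T * K]mulVf ?gt_eqF// mul1r in h.
  have -> : Q b - al * dot p b ^+ 2 + be * dot b b = Q b -
     T * (m * (1 + K ^+ 2) * (- mu * dot p b) ^+ 2 -
       4 * dot b b / (1 - s ^+ 2) -
       16 * s * dot p b ^+ 2 / (1 - s ^+ 2) ^+ 2).
    by rewrite /al /be /mu /T; field; rewrite !gt_eqF.
  by rewrite subr_le0.
(* The Hessian of [u] minus the one of the barrier. *)
pose N : 'M[R]_n := hessian u p - al *: (p^T *m p) + be%:M.
have NE (b : 'rV[R]_n) : (b *m N *m b^T) 0 0 =
    Q b - al * dot p b ^+ 2 + be * dot b b.
  rewrite /N mulmxDr mulmxBr !mulmxDl mulNmx -scalemxAr -scalemxAl dot_mulmx_sqr.
  rewrite mul_mx_scalar -scalemxAl dot_mulmx /Q.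
  rewrite !mxE !eqxx !mulr1n.
  by congr (_ - _ + _ * _); apply: eq_bigr => j _; rewrite [_^T _ _]mxE.
have N_le0 (b : 'rV[R]_n) : (b *m N *m b^T) 0 0 <= 0.
  by rewrite NE.
pose F := ((1 - s) / 2) ^+ 2; pose t2 := 1 + F * (mu ^+ 2 * s).
pose a := F * mu ^+ 2 / t2.
have F0 : 0 <= F by rewrite sqr_ge0.
have t20 : 0 < t2 by rewrite ltr_wpDr// mulr_ge0 ?sqr_ge0// mulr_ge0 ?sqr_ge0// ltW.
have as1 : a * dot p p <= 1.
  by rewrite -/s /a mulrAC ler_pdivrMr// mul1r /t2 -mulrA lerDr.
have tr := trace_rank1_le N_le0 s0 as1.
rewrite NE -/s in tr.
have trN : \tr N = \tr (hessian u p) - al * s + be * n%:R.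
  rewrite /N linearD linearB linearZ /= mxtrace_mulC dot_mulmx -/s !mxtrace_scalar.
  by rewrite mulr1n mulr_natr.
rewrite trN in tr.
have := minimal_graph_expand C2u (nbhs_singleton pD) s1 ueq.
rewrite /= -/v -/s.
have vv : dot v v = mu ^+ 2 * s.
  rewrite bvE vE /s /dot !mulr_sumr; apply: eq_bigr => i _; rewrite mxE; ring.
rewrite vv bvE -/F -/t2 -/s => pde.
have Qv : (v *m hessian u p *m v^T) 0 0 = mu ^+ 2 * Q p.
  rewrite vE [_^T]linearZ /= -scalemxAr -!scalemxAl scalerA mxE /Q.
  by congr (_ * _); ring.
rewrite Qv in pde.
have := barrier_identity n%:R T (ltW s0) s1.
rewrite /= -/mu -/F -/t2 -/a -/m -/al -/be => id.
have : 0 < 4 * n%:R * T / (t2 * (1 + s) ^+ 2).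
  by rewrite divr_gt0 ?mulr_gt0 ?exprn_gt0 ?ltr0n ?(ltn_trans _ n1)//
    ltr_wpDr// ltW.
(* The equation, with the Hessian terms isolated. *)
have pde2 : \tr (hessian u p) - a * Q p = (1 - s) * mu ^+ 3 * s ^+ 2 / (2 * t2) +
   2 * (n%:R - 2) * mu * s / (1 - s).
  apply/eqP; rewrite -subr_eq0 -pde; apply/eqP; rewrite /a; field.
  by rewrite !gt_eqF//; lra.
rewrite -pde2 in id.
move: id tr.
have -> : a * (Q p - al * s ^+ 2 + be * s) =
  a * Q p - al * (s * (a * s)) + be * (a * s) by ring.
have -> : al * (s * (1 - a * s)) = al * s - al * (s * (a * s)) by ring.
have -> : be * (n%:R - a * s) = be * n%:R - be * (a * s) by ring.
lra.
Qed.

(** * The Euclidean norm, components and compactness *)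

Lemma continuous_dot (R : realType) (n : nat) :
  continuous (fun p : 'rV[R]_n => dot p p).
Proof.
apply: (@continuous_big R 'I_n +%R 0 xpredT _ _ _
  (fun i (p : 'rV[R]_n) => p 0 i * p 0 i)); first exact: add_continuous.
move=> i _ p; have c := @coord_continuous R 1 n 0 i p. exact: (cvgM c c).
Qed.

Lemma enorm_ge0 (R : realType) (n : nat) (p : 'rV[R]_n) : 0 <= enorm p.
Proof. exact: sqrtr_ge0. Qed.

Lemma continuous_enorm (R : realType) (n : nat) :
  continuous (@enorm R n).
Proof.
move=> p; apply: (@continuous_comp _ _ _ (fun p => dot p p) Num.sqrt).
  exact: continuous_dot.
exact: sqrt_continuous.
Qed.

Lemma enormZ (R : realType) (n : nat) (c : R) (p : 'rV[R]_n) :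
  enorm (c *: p) = `|c| * enorm p.
Proof.
rewrite /enorm -sqrtr_sqr -sqrtrM ?sqr_ge0//; congr Num.sqrt.
by rewrite /dot mulr_sumr; apply: eq_bigr => i _; rewrite !mxE; ring.
Qed.

Lemma dot_gt0 (R : realType) (n : nat) (p : 'rV[R]_n) : p != 0 -> 0 < dot p p.
Proof.
move=> p0; rewrite lt_neqAle dot_ge0 andbT; apply: contraNneq p0 => /esym d0.
apply/eqP/rowP => i; rewrite mxE.
have : forall i : 'I_n, true -> p 0 i * p 0 i = 0.
  by apply/psumr_eq0P => // j _; rewrite -expr2 sqr_ge0.
by move=> /(_ i isT) /eqP; rewrite mulf_eq0 orbb => /eqP.
Qed.

Lemma norm_le_enorm (R : realType) (n : nat) (p : 'rV[R]_n) : `|p| <= enorm p.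
Proof.
rewrite [leLHS]mx_normrE; apply: bigmax_le; first exact: enorm_ge0.
move=> -[i j] _ /=; rewrite ord1 -sqrtr_sqr ler_sqrt ?dot_ge0//.
rewrite /dot (bigD1 j)//= expr2 lerDl; apply: sumr_ge0 => k _.
by rewrite -expr2 sqr_ge0.
Qed.

Lemma closed_enorm_le (R : realType) (n : nat) (r : R) :
  closed [set p : 'rV[R]_n | enorm p <= r].
Proof.
apply: (@closed_comp _ _ (@enorm R n) [set x | x <= r]) (@closed_le R r) => p _.
exact: continuous_enorm.
Qed.

Lemma closed_enorm_ge (R : realType) (n : nat) (r : R) :
  closed [set p : 'rV[R]_n | r <= enorm p].
Proof.
apply: (@closed_comp _ _ (@enorm R n) [set x | r <= x]) (@closed_ge R r) => p _.
exact: continuous_enorm.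
Qed.

Lemma open_Hyp (R : realType) (n : nat) : open (@Hyp R n).
Proof.
apply: (@open_comp _ _ (@enorm R n) [set x | x < 1]) (@open_lt R 1) => p _.
exact: continuous_enorm.
Qed.

Lemma open_enorm_gt (R : realType) (n : nat) (r : R) :
  open [set p : 'rV[R]_n | r < enorm p].
Proof.
apply: (@open_comp _ _ (@enorm R n) [set x | r < x]) (@open_gt R r) => p _.
exact: continuous_enorm.
Qed.

Lemma compact_enorm_le (R : realType) (n : nat) (A : set 'rV[R]_n) (r : R) :
  closed A -> A `<=` [set p | enorm p <= r] -> compact A.
Proof.
move=> Acl Ar; apply: bounded_closed_compact => //.
exists r; split; first exact: num_real.
move=> x rx p /Ar pr /=; apply: le_trans (norm_le_enorm p) _.
exact: le_trans pr (ltW rx).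
Qed.

Lemma component_segment (R : realType) (n : nat) (A : set 'rV[R]_n)
  (x y z : 'rV[R]_n) : connected_component A x y ->
  (forall t : R, 0 <= t -> t <= 1 -> A (y + t *: (z - y))) ->
  connected_component A x z.
Proof.
move=> xy yz; apply: connected_component_trans xy _.
pose f (t : R) := y + t *: (z - y).
exists (f @` `[0, 1]); last first.
  by exists 1; rewrite /= ?in_itv /= ?ler01 ?lexx// /f scale1r addrC subrK.
split.
- by exists 0; rewrite /= ?in_itv /= ?ler01 ?lexx// /f scale0r addr0.
- by move=> _ [t /= + <-]; rewrite in_itv /= => /andP[t0 t1]; exact: yz.
apply: connected_continuous_connected; first exact: segment_connected.
apply: continuous_subspaceT => t.
by apply: cvgD; [exact: cvg_cst | apply: cvgZr_tmp; exact: cvg_id].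
Qed.

Lemma ball_segment (R : realType) (n : nat) (y z : 'rV[R]_n) (e t : R) :
  ball y e z -> 0 <= t -> t <= 1 -> ball y e (y + t *: (z - y)).
Proof.
rewrite -!ball_normE /= => yz t0 t1.
rewrite opprD addrA subrr sub0r normrN normrZ ger0_norm//.
by rewrite distrC in yz; apply: le_lt_trans yz; rewrite ler_piMl.
Qed.

Lemma component_open (R : realType) (n : nat) (A : set 'rV[R]_n) x :
  open A -> open (connected_component A x).
Proof.
rewrite !openE => Ao y xy.
have /nbhs_ballP[e /= e0 He] := Ao _ (connected_component_sub xy).
apply/nbhs_ballP; exists e => // z yz; apply: component_segment xy _ => t t0 t1.
exact/He/ball_segment.
Qed.

Lemma component_closure (R : realType) (n : nat) (A : set 'rV[R]_n) x y :
  open A -> closure (connected_component A x) y -> A y ->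
  connected_component A x y.
Proof.
rewrite openE => Ao xy Ay.
have /nbhs_ballP[e /= e0 He] := Ao _ Ay.
have [z [xz yz]] := xy _ (nbhsx_ballx y e e0).
apply: (component_segment xz) => t t0 t1; apply: He.
rewrite (_ : _ + _ = y + (1 - t) *: (z - y)).
  by apply: ball_segment => //; lra.
rewrite scalerBl scale1r [t *: (z - y)](_ : _ = - (t *: (y - z))); last first.
  by rewrite -scalerN opprB.
by rewrite opprK addrA [y + (_ - _)]addrC subrK.
Qed.

Lemma sphere_compact (R : realType) (n : nat) : compact (@sphere R n).
Proof.
apply: (@compact_enorm_le _ _ _ 1) => [|p /= ->//].
rewrite (_ : @sphere R n = [set p | enorm p <= 1] `&` [set p | 1 <= enorm p]).
  by apply: closedI; [exact: closed_enorm_le | exact: closed_enorm_ge].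
apply/seteqP; split=> p /=; first by rewrite /sphere /= => ->.
by case=> a b; apply/eqP; rewrite eq_le a.
Qed.

Lemma sphere_nonempty (R : realType) (n : nat) : (0 < n)%N ->
  @sphere R n !=set0.
Proof.
case: n => // n _; exists (delta_mx 0 ord0).
by rewrite /sphere /= /enorm dot_delta mxE !eqxx sqrtr1.
Qed.

Lemma vproj_compact (R : realType) (n : nat) (S : set ('rV[R]_n * R)) :
  homeomorphic_sets (@sphere R n) S -> compact (vproj S).
Proof.
move=> [f [g [fc _ fS gS]]].
have -> : vproj S = (fst \o f) @` @sphere R n.
  apply/seteqP; split=> [_ [y Sy <-]|_ [x sx <-]].
    by exists (g y); rewrite /=; [exact: (gS _ Sy).1 | rewrite (gS _ Sy).2].
  by exists (f x) => //; exact: (fS _ sx).1.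
apply: continuous_compact; last exact: sphere_compact.
move=> x; apply: (@continuous_comp (subspace (@sphere R n)) _ _ f fst x (fc x)).
exact: cvg_fst.
Qed.

Lemma vproj_nonempty (R : realType) (n : nat) (S : set ('rV[R]_n * R)) :
  (0 < n)%N -> homeomorphic_sets (@sphere R n) S -> vproj S !=set0.
Proof.
move=> n0 [f [g [_ _ fS _]]]; have [x sx] := sphere_nonempty R n0.
by exists (f x).1; exists (f x) => //; exact: (fS _ sx).1.
Qed.

(** * Height bound outside a ball *)

Lemma within_continuous_at (R : realType) (n : nat) (D : set 'rV[R]_n)
  (u : 'rV[R]_n -> R) p :
  {within closure D, continuous u} -> nbhs p D -> {for p, continuous u}.
Proof.
move=> uc pD; have := uc p; rewrite /continuous_at.
rewrite -nbhs_subspace_interior//.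
by apply: filterS pD => q; exact: subset_closure.
Qed.

(** [ln lambda] is increasing in [s]. *)
Lemma ln_ratio_le (R : realType) (x y : R) : 0 <= x -> x <= y -> y < 1 ->
  ln (1 + x) - ln (1 - x) <= ln (1 + y) - ln (1 - y).
Proof. by move=> x0 xy y1; apply: lerB; rewrite ler_ln ?posrE; lra. Qed.

Lemma ln_ratio_lt (R : realType) (x y : R) : 0 <= x -> x < y -> y < 1 ->
  ln (1 + x) - ln (1 - x) < ln (1 + y) - ln (1 - y).
Proof. by move=> x0 xy y1; apply: ltrB; rewrite ltr_ln ?posrE; lra. Qed.

Lemma dot_le_sqr (R : realType) (n : nat) (p : 'rV[R]_n) (r : R) :
  enorm p <= r -> dot p p <= r ^+ 2.
Proof.
move=> pr; rewrite -enorm_sqr ler_sqr// nnegrE ?enorm_ge0//.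
exact: le_trans (enorm_ge0 p) pr.
Qed.

Lemma sqr_lt_dot (R : realType) (n : nat) (p : 'rV[R]_n) (r : R) :
  0 <= r -> r < enorm p -> r ^+ 2 < dot p p.
Proof. by move=> r0 pr; rewrite -enorm_sqr ltr_sqr// nnegrE ?enorm_ge0. Qed.

(** A minimal graph whose boundary outside the ball of radius [r0] is at height
    [0] stays, over the exterior of that ball, below [pi / (2 n - 2)] by a
    uniform margin.  The part of the boundary inside the closed ball is
    arbitrary. *)
Lemma height_bound (R : realType) (n : nat) (Om : set 'rV[R]_n)
  (u : 'rV[R]_n -> R) (r0 r1 : R) :
  (1 < n)%N -> 0 <= r0 -> 0 <= r1 -> r1 < 1 ->
  closure Om `<=` [set p | enorm p <= r1] ->
  (forall p, closure Om p -> r0 < enorm p -> u p = 0 \/ nbhs p Om) ->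
  C2_on Om u -> {within closure Om, continuous u} ->
  (forall p, Om p -> minimal_graph_equation u p) ->
  exists2 dl : R, 0 < dl &
    forall q, Om q -> r0 < enorm q -> dl + (n%:R - 1) * u q < pi / 2.
Proof.
move=> n1 r00 r10 r11 clOm bd C2u uc ueq.
set m := n%:R - 1.
have m0 : 0 < m by rewrite subr_gt0 ltr1n.
pose L (x : R) := ln (1 + x) - ln (1 - x).
have r1s : r1 ^+ 2 < 1 by rewrite expr_lt1.
have L1 : 0 <= L (r1 ^+ 2).
  have := @ln_ratio_le R 0 (r1 ^+ 2) (lexx _) (sqr_ge0 _) r1s.
  by rewrite addr0 subr0 subrr.
(* [dl] makes [J] nonpositive where [u <= 0], the norm being at most [r1]. *)
pose sd := expR (- (m * L (r1 ^+ 2))).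
have sd0 : 0 < sd by exact: expR_gt0.
have sd1 : sd <= 1 by rewrite -expR0 ler_expR oppr_le0 mulr_ge0// ltW.
have sdi : -1 <= sd <= 1 by rewrite sd1 andbT; lra.
pose dl := asin sd.
have sindl : sin dl = sd by apply: asinK; rewrite in_itv.
have pi0 := pi_gt0 R.
have dlpi : dl <= pi / 2 by exact: asin_lepi2.
have dl0 : 0 < dl.
  rewrite ltNge; apply/negP => dl0.
  have : 0 <= sin (- dl).
    apply: sin_ge0_pi; rewrite oppr_ge0 dl0 /=.
    by have := asin_geNpi2 sdi; rewrite -/dl; lra.
  by rewrite sinN sindl; lra.
exists dl => // q Omq r0q; rewrite ltNge; apply/negP => uq.
pose th (z : R) := Num.min (dl + m * Num.max z 0) (pi / 2).
have th0 z : 0 < th z.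
  rewrite lt_min divr_gt0// andbT ltr_wpDr// mulr_ge0 ?(ltW m0)//.
  by rewrite le_max lexx orbT.
have sin0 z : 0 < sin (th z).
  apply: sin_gt0_pi; rewrite th0 /=.
  by rewrite gt_min; apply/orP; right; lra.
pose J p := ln (sin (th (u p))) + m * L (dot p p).
pose K := closure Om `&` [set p | r0 <= enorm p].
have Kq : K q by split; [exact: subset_closure | exact: ltW].
have Kcl : closed K.
  by apply: closedI; [exact: closed_closure | exact: closed_enorm_ge].
have Kco : compact K := compact_enorm_le Kcl (fun p Kp => clOm p Kp.1).
have Kdot p : closure Om p -> dot p p <= r1 ^+ 2.
  by move=> /clOm; exact: dot_le_sqr.
have Kdot1 p : closure Om p -> dot p p < 1.
  by move=> /Kdot h; apply: le_lt_trans h r1s.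
have thc : continuous th.
  move=> z.
  apply: (@continuous_min R R (fun z => dl + m * Num.max z 0) (fun=> pi / 2));
    last exact: cvg_cst.
  apply: cvgD; first exact: cvg_cst.
  apply: cvgM; first exact: cvg_cst.
  by apply: (@continuous_max R R id (fun=> 0)); [exact: cvg_id | exact: cvg_cst].
have Jc : {within K, continuous J}.
  apply/subspace_continuousP => x Kx.
  have ux : u @ within K (nbhs x) --> u x.
    have /subspace_continuousP/(_ x Kx) : {within K, continuous u}.
      by apply: continuous_subspaceW uc => p [].
    exact.
  have c1 : {for u x, continuous (fun z => ln (sin (th z)))}.
    apply: (@continuous_comp _ _ _ (fun z => sin (th z)) (@ln R)).
      apply: (@continuous_comp _ _ _ th (@sin R)); first exact: thc.
      exact: continuous_sin.
    exact: continuous_ln.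
  have c2 : {for x, continuous (fun p : 'rV[R]_n => L (dot p p))}.
    apply: (@continuous_comp _ _ _ (fun p : 'rV[R]_n => dot p p) L).
      exact: continuous_dot.
    have x1 := Kdot1 _ Kx.1; have x0 := dot_ge0 x.
    apply: cvgB.
      apply: (@continuous_comp _ _ _ (fun z : R => 1 + z) (@ln R)).
        by apply: cvgD; [exact: cvg_cst | exact: cvg_id].
      by apply: continuous_ln; rewrite ltr_wpDr.
    apply: (@continuous_comp _ _ _ (fun z : R => 1 - z) (@ln R)).
      by apply: cvgB; [exact: cvg_cst | exact: cvg_id].
    by apply: continuous_ln; rewrite subr_gt0.
  apply: cvgD.
    exact: (cvg_comp _ _ ux c1).
  apply: cvgM; first exact: cvg_cst.
  by apply: cvg_trans c2; apply: cvg_app; exact: cvg_within.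
have [p /set_mem Kp pmax] := compact_EVT_max (ex_intro _ q Kq) Kco Jc.
have {}pmax x : K x -> J x <= J p by move=> Kx; apply: pmax; exact/mem_set.
have Jle x : K x -> J x <= m * L (dot x x).
  by move=> _; rewrite gerDr ln_le0// sin_le1.
have Jplateau x : pi / 2 <= dl + m * u x -> J x = m * L (dot x x).
  move=> ux; rewrite /J /th min_r ?sin_pihalf ?ln1 ?add0r//.
  apply: le_trans ux _; rewrite lerD2l ler_wpM2l ?(ltW m0)//.
  by rewrite le_max lexx.
(* [q] is on the plateau, so the maximum exceeds the value for norm [r0]. *)
have Jp : m * L (r0 ^+ 2) < J p.
  apply: lt_le_trans (pmax _ Kq); rewrite Jplateau// ltr_pM2l//.
  apply: ln_ratio_lt; [exact: sqr_ge0 | exact: sqr_lt_dot | ].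
  exact/Kdot1/subset_closure.
have r0s : r0 ^+ 2 < 1.
  by apply: lt_trans (sqr_lt_dot r00 r0q) _; exact/Kdot1/subset_closure.
have L0 : 0 <= L (r0 ^+ 2).
  have := @ln_ratio_le R 0 (r0 ^+ 2) (lexx _) (sqr_ge0 _) r0s.
  by rewrite addr0 subr0 subrr.
have [clp r0p'] := Kp.
have r0p : r0 < enorm p.
  rewrite lt_neqAle r0p' andbT; apply/negP => /eqP e.
  by have := Jle _ Kp; rewrite leNgt -enorm_sqr -e Jp.
have up : 0 < u p.
  rewrite ltNge; apply/negP => up.
  suff : J p <= 0.
    by rewrite leNgt (le_lt_trans _ Jp)// mulr_ge0// ltW.
  rewrite /J /th max_r// mulr0 addr0 min_l// sindl /sd expRK addrC subr_le0.
  rewrite ler_wpM2l ?(ltW m0)//; apply: ln_ratio_le => //.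
  - exact: dot_ge0.
  - exact: Kdot.
have Omp : nbhs p Om by have [u0|//] := bd p clp r0p; move: up; rewrite u0 ltxx.
have ucp := within_continuous_at uc Omp.
have r0near : \forall x \near p, r0 < enorm x.
  exact: (cvgr_gt _ (@continuous_enorm R n p) _ r0p).
have nearK : \forall x \near p, K x.
  near=> x; split; first by apply: subset_closure; near: x.
  by apply/ltW; near: x.
have dotp0 : 0 < dot p p.
  by apply: le_lt_trans (sqr_lt_dot r00 r0p); exact: sqr_ge0.
have c : {for p, continuous (fun x => dl + m * u x)}.
  apply: (@continuous_comp _ _ _ u (fun z : R => dl + m * z)); first exact: ucp.
  apply: cvgD; first exact: cvg_cst.
  by apply: cvgM; [exact: cvg_cst | exact: cvg_id].
have [big|small] := ltrP (pi / 2) (dl + m * u p).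
  (* On the plateau [J] does not depend on [u], and moving outwards increases
     it. *)
  have bignear : \forall x \near p, K x /\ pi / 2 < dl + m * u x.
    near=> x; split; first by near: x.
    by near: x; exact: (cvgr_gt _ c _ big).
  have ct : p + t *: p @[t --> (0 : R)^'+] --> p.
    rewrite -[X in _ --> X](_ : p + (0 : R) *: p = p); last first.
      by rewrite scale0r addr0.
    apply: cvg_at_right_filter.
    by apply: cvgD; [exact: cvg_cst | apply: cvgZr_tmp; exact: cvg_id].
  have [t [t0 [Kt bigt]]] : exists t : R, 0 < t /\
      (K (p + t *: p) /\ pi / 2 < dl + m * u (p + t *: p)).
    have /filter_ex : \forall t \near (0 : R)^'+, 0 < t /\
        (K (p + t *: p) /\ pi / 2 < dl + m * u (p + t *: p)).
      near=> t; split; first by near: t; exact: nbhs_right_gt.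
      by near: t; exact: (ct _ bignear).
    by [].
  have := pmax _ Kt; rewrite leNgt !Jplateau ?ltW// => /negP; apply.
  rewrite ltr_pM2l//.
  apply: ln_ratio_lt; [exact: dot_ge0 | | exact: Kdot1 Kt.1].
  by rewrite dot_line -addrA ltrDl addr_gt0// !mulr_gt0// exprn_gt0.
(* Off the plateau [J] dominates the untruncated function near [p], because
   [sin] is at most [1]. *)
apply: (no_touching n1 Omp C2u (ueq _ (nbhs_singleton Omp)) dotp0 (Kdot1 _ clp)
  (_ : 0 < dl + m * u p) small).
  by rewrite addr_gt0// mulr_gt0.
have thpi : dl + m * u p < pi by lra.
near=> x.
have Kx : K x by near: x.
have ux : 0 < u x by near: x; exact: (cvgr_gt _ ucp _ up).
have xpi : dl + m * u x < pi by near: x; exact: (cvgr_lt _ c _ thpi).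
have x0 : 0 < dl + m * u x by rewrite addr_gt0// mulr_gt0.
have -> : ln (sin (dl + (n%:R - 1) * u p)) +
    (n%:R - 1) * (ln (1 + dot p p) - ln (1 - dot p p)) = J p.
  by rewrite /J /th max_l ?ltW// min_l.
apply: le_trans (pmax _ Kx); rewrite lerD2r ler_ln ?posrE ?sin0//; last first.
  by apply: sin_gt0_pi; rewrite x0.
rewrite /th max_l ?(ltW ux)//; case: (leP (dl + m * u x) (pi / 2)) => h.
  by [].
by rewrite sin_pihalf sin_le1.
Unshelve. all: by end_near. Qed.

(** * Nonexistence *)

(** A point of [D] of norm greater than [r0] could be moved radially, within
    [D], beyond the radius [r] that bounds [D]. *)
Lemma enclosed_domain_enorm_le (R : realType) (n : nat) (S D : set 'rV[R]_n)
  (r0 : R) : 0 <= r0 -> S `<=` [set p | enorm p <= r0] ->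
  enclosed_domain S D -> D `<=` [set p | enorm p <= r0].
Proof.
move=> r00 Sr0 [[x _ DE] [r r1 Dr]] q Dq /=; rewrite leNgt; apply/negP => r0q.
have q1 : enorm q < 1 by apply: le_lt_trans (Dr _ Dq) r1.
have qr := Dr _ Dq; rewrite /= in qr.
have q0 : 0 < enorm q by exact: le_lt_trans r0q.
pose c := (1 + r) / 2 / enorm q.
have cq : c * enorm q = (1 + r) / 2 by rewrite divfK// gt_eqF.
have c1 : 1 <= c by rewrite ler_pdivlMr// mul1r; lra.
have Dcq : D (c *: q).
  move: Dq; rewrite DE => Dq; apply: component_segment Dq _ => t t0 t1.
  rewrite (_ : q + _ = (1 + t * (c - 1)) *: q); last first.
    by rewrite -[X in _ *: (_ - X)]scale1r -scalerBl scalerA scalerDl scale1r.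
  have tc : 0 <= t * (c - 1) by rewrite mulr_ge0// subr_ge0.
  have tc1 : t * (c - 1) <= c - 1 by rewrite ler_piMl// subr_ge0.
  have eE : enorm ((1 + t * (c - 1)) *: q) = (1 + t * (c - 1)) * enorm q.
    by rewrite enormZ ger0_norm// addr_ge0.
  split.
    rewrite /Hyp /= eE; apply: (@le_lt_trans _ _ (c * enorm q)); last first.
      by rewrite cq; lra.
    by rewrite ler_wpM2r ?(ltW q0)//; lra.
  move=> /Sr0 /=; rewrite eE leNgt => /negP; apply.
  by apply: lt_le_trans r0q _; rewrite ler_peMl ?(ltW q0)// lerDl.
have := Dr _ Dcq; rewrite /= enormZ ger0_norm ?cq; last by lra.
lra.
Qed.

Unset Implicit Arguments.

Theorem proposition1p3 (R : realType) (n : nat) (h : R)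
  (alpha beta : set ('rV[R]_n * R)) (Dalpha Dbeta Omega : set 'rV[R]_n)
  (hn : (2 <= n)%N) (hh : 0 < h)
  (alpha_slice : alpha `<=` @slice R n 0)
  (beta_slice : beta `<=` @slice R n h)
  (alpha_sphere : homeomorphic_sets (@sphere R n) alpha)
  (beta_sphere : homeomorphic_sets (@sphere R n) beta)
  (Dalpha_enclosed : enclosed_domain (vproj alpha) Dalpha)
  (Dbeta_enclosed : enclosed_domain (vproj beta) Dbeta)
  (beta_inside : vproj beta `<=` Dalpha)
  (Omega_between : Omega = Dalpha `\` (vproj beta `|` Dbeta))
  (h_ge : pi / (2 * n%:R - 2) <= h) :
  ~ exists M : set ('rV[R]_n * R),
      [/\ minimal_vertical_graph Omega (vproj alpha) (vproj beta) h M,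
          connected M & compact M].
Proof.
move=> [M [[u [[C2u uc] ua ub ueq _]] _ _]].
set A := vproj alpha in ua Dalpha_enclosed *.
set B := vproj beta in ub Dbeta_enclosed beta_inside Omega_between *.
have Acl : closed A.
  by apply: compact_closed; [exact: norm_hausdorff | exact: vproj_compact].
have Bco : compact B by exact: vproj_compact.
have [p0 Bp0 p0max] : exists2 p0, B p0 & forall p, B p -> enorm p <= enorm p0.
  have [|||p0 /set_mem Bp0 p0max] := @compact_EVT_max _ R (@enorm R n) B.
  - by apply: vproj_nonempty beta_sphere; exact: ltn_trans hn.
  - exact: Bco.
  - by apply: continuous_subspaceT => x; exact: continuous_enorm.
  by exists p0 => // p Bp; apply: p0max; exact/mem_set.
set r0 := enorm p0 in p0max.
have r00 : 0 <= r0 by exact: enorm_ge0.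
have Dbr0 := enclosed_domain_enorm_le r00 p0max Dbeta_enclosed.
have [[x _ DE] [r1 r11 Dr1]] := Dalpha_enclosed.
have HAo : open (@Hyp R n `\` A).
  by apply: openI; [exact: open_Hyp | exact: closed_openC].
have Do : open Dalpha by rewrite DE; exact: component_open.
have clDr1 : closure Dalpha `<=` [set p | enorm p <= r1].
  rewrite closureE; apply: smallest_sub => //; exact: closed_enorm_le.
have OmD : Omega `<=` Dalpha by rewrite Omega_between => p [].
have clOm : closure Omega `<=` closure Dalpha by exact: closure_subset.
have r10 : 0 <= r1 by apply: le_trans r00 (Dr1 _ (beta_inside _ Bp0)).
have DOm p : Dalpha p -> r0 < enorm p -> Omega p.
  move=> Dp r0p; rewrite Omega_between; split => // -[/p0max|/Dbr0] /=.
    by rewrite leNgt r0p.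
  by rewrite leNgt r0p.
have bd p : closure Omega p -> r0 < enorm p -> u p = 0 \/ nbhs p Omega.
  move=> /clOm clp r0p; have [Ap|nAp] := pselect (A p); first by left; exact: ua.
  right.
  have Dp : Dalpha p.
    rewrite DE; apply: component_closure => //; first by rewrite -DE.
    by split=> //; apply: le_lt_trans (clDr1 _ clp) r11.
  near=> q; apply: DOm; near: q.
    exact: open_nbhs_nbhs.
  by apply: open_nbhs_nbhs; split => //; exact: open_enorm_gt.
have [dl dl0 ule] := height_bound hn r00 r10 r11
  (subset_trans clOm clDr1) bd C2u uc ueq.
set m := n%:R - 1 in ule.
have m0 : 0 < m by rewrite subr_gt0 ltr1n.
have mh : pi / 2 <= m * h.
  move: h_ge; rewrite (_ : 2 * n%:R - 2 = 2 * m); last by rewrite /m; ring.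
  by rewrite invfM mulrA ler_pdivrMr// [m * h]mulrC.
(* A direction along which the norm increases from [p0]; the case [p0 = 0] is
   not excluded. *)
have [v [v0 pv]] : exists v : 'rV[R]_n, v != 0 /\ 0 <= dot p0 v.
  have [->|p00] := eqVneq p0 0; last by exists p0; split => //; exact: dot_ge0.
  exists (delta_mx 0 (Ordinal (ltnW hn))); split.
    apply/eqP => /rowP /(_ (Ordinal (ltnW hn))) /eqP.
    by rewrite !mxE !eqxx oner_eq0.
  by rewrite dot_delta mxE.
have out t : 0 < t -> r0 < enorm (p0 + t *: v).
  have lt_dot : 0 < t -> dot p0 p0 < dot (p0 + t *: v) (p0 + t *: v).
    move=> t0; rewrite dot_line -addrA ltrDl ltr_wpDl//.
      by rewrite !mulr_ge0// ltW.
    by rewrite mulr_gt0 ?exprn_gt0// dot_gt0.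
  by move=> /lt_dot d; rewrite /r0 /enorm ltr_sqrt// (le_lt_trans (dot_ge0 p0)).
have ct : p0 + t *: v @[t --> (0 : R)^'+] --> p0.
  rewrite -[X in _ --> X](_ : p0 + (0 : R) *: v = p0); last first.
    by rewrite scale0r addr0.
  apply: cvg_at_right_filter.
  by apply: cvgD; [exact: cvg_cst | apply: cvgZr_tmp; exact: cvg_id].
have Dp0 : nbhs p0 Dalpha.
  by apply: open_nbhs_nbhs; split => //; exact: beta_inside.
have near_out P : nbhs p0 P -> exists2 q, P q & Omega q /\ r0 < enorm q.
  move=> Pp0.
  have /filter_ex [t [t0 [Pt Dt]]] : \forall t \near (0 : R)^'+,
      0 < t /\ (P (p0 + t *: v) /\ Dalpha (p0 + t *: v)).
    near=> t; split; first by near: t; exact: nbhs_right_gt.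
    by near: t; exact: (ct _ (filterI Pp0 Dp0)).
  have r0t := out _ t0.
  by exists (p0 + t *: v) => //; split => //; exact: DOm.
have clp0 : closure Omega p0.
  by move=> P /near_out [q Pq [Oq _]]; exists q.
have uh : u @ within (closure Omega) (nbhs p0) --> h.
  by rewrite -(ub _ Bp0); move/subspace_continuousP : uc; exact.
have hlt : h - dl / m < h by rewrite ltrBlDr ltrDl divr_gt0.
have [q hq [Oq r0q]] := near_out _ (cvgr_gt _ uh _ hlt).
have := ule _ Oq r0q; apply/negP; rewrite -leNgt.
have := hq (subset_closure Oq).
rewrite ltrBlDr -(ltr_pM2l m0) mulrDr mulrCA divff ?gt_eqF// mulr1 => /ltW.
by move=> /(le_trans mh); rewrite addrC.
Unshelve. all: by end_near. Qed.
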